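(* Let $\kappa$ be an infinite cardinal and $n\in\omega$. If $\square_{\kappa^{+m}}$ holds for every $m<n$, then there exists an $(n+1,\kappa)$-ladder of cardinality $\kappa^{+n}$.
   Context: $\square_\lambda$ is Jensen's square principle: there is a sequence $\langle C_\alpha\mid \alpha<\lambda^+ \text{ limit}\rangle$ with $C_\alpha$ club in $\alpha$, $\mathrm{otp}(C_\alpha)\le\lambda$, and $C_\beta=C_\alpha\cap\beta$ whenever $\beta$ is a limit point of $C_\alpha$. For a set $X$, let $\overline{X}^{\top}$ denote the join-semilattice with underlying set $X\sqcup\{\mathbf 1\}$ in which $x\vee y=\mathbf 1$ for all distinct $x,y$; for $k\in\omega$, $\overline{k}^{\top}$ is this with $X=\{0,\dots,k-1\}$. A join-semilattice is $\overline{k}^{\top}$-free if it has no join-subsemilattice isomorphic to $\overline{k}^{\top}$. For $m\in\omega$ and infinite cardinal $\kappa$, an $(m,\kappa)$-ladder is a nonempty lattice that is $\overline{(m+1)}^{\top}$-free and all of whose principal ideals have cardinality $<\kappa$. *)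

(* Defs.v *)
From HB Require Import structures.
From mathcomp Require Import all_boot all_order.
From mathcomp Require Import boolp classical_sets functions cardinality wochoice.

Set Implicit Arguments.
Unset Strict Implicit.
Unset Printing Implicit Defensive.

Import Order.TTheory.

Local Open Scope classical_set_scope.
Local Open Scope card_scope.
Local Open Scope order_scope.

(** Ordinals are represented by well-ordered types [W], a point [x : W] standing
    for the ordinal below [W] given by [{y | y < x}]; cardinals are initial
    ordinals. *)

Record cardinal := Cardinal {
  card_disp : Order.disp_t;
  card_order :> orderType card_disp;
  card_well_order : well_order (<=%O : rel card_order);
  card_initial :
    forall x : card_order, [set y | y < x] #!= [set: card_order]
}.

Definition card_lt T U (A : set T) (B : set U) : Prop :=
  A #<= B /\ A #!= B.

(** ** Successor cardinals *)

(** Fix a well-order of the powerset of [T]. By Cantor's theorem, its points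
    with at most [T]-many predecessors form an initial segment whose order type
    is the least ordinal that does not inject into [T], i.e. the successor
    cardinal of [T] (see [csucc_sort_segment] and [csucc_sort_gt]). *)
Definition wo_pow (T : Type) : Type := set T.
HB.instance Definition _ (T : Type) := Choice.on (wo_pow T).

Definition wo_pow_le (T : Type) : rel (wo_pow T) :=
  sval (well_ordering_principle (wo_pow T)).

Section WoPow.
Variable T : Type.

Let le_wo : well_order (@wo_pow_le T) :=
  svalP (well_ordering_principle (wo_pow T)).

Let le_woW : wo_chain (@wo_pow_le T) predT.
Proof. by move=> A _; apply: le_wo. Qed.

Fact wo_pow_le_refl : reflexive (@wo_pow_le T).
Proof. by move=> x; apply: (wo_chain_reflexive le_woW). Qed.

Fact wo_pow_le_anti : antisymmetric (@wo_pow_le T).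
Proof. by move=> x y; apply: (wo_chain_antisymmetric le_woW). Qed.

Fact wo_pow_le_total : total (@wo_pow_le T).
Proof. by move=> x y; apply: (wo_chainW le_woW). Qed.

Fact wo_pow_le_trans : transitive (@wo_pow_le T).
Proof.
move=> y x z xy yz.
have [|w [[wA wmin] _]] := le_wo (A := [pred t | t \in [:: x; y; z]]).
  by exists x; rewrite !inE eqxx.
have wx : wo_pow_le w x by apply: wmin; rewrite !inE eqxx.
have wy : wo_pow_le w y by apply: wmin; rewrite !inE eqxx orbT.
have wz : wo_pow_le w z by apply: wmin; rewrite !inE eqxx !orbT.
move: wA; rewrite !inE => /or3P[] /eqP ew; subst w => //.
- by rewrite (@wo_pow_le_anti x y) // xy wx.
- by rewrite -(@wo_pow_le_anti y z) ?yz ?wy.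
Qed.

End WoPow.

Fact wo_pow_display : Order.disp_t. Proof. exact: Order.Disp tt tt. Qed.

HB.instance Definition _ (T : Type) :=
  @Order.Le_isPOrder.Build wo_pow_display (wo_pow T) (@wo_pow_le T)
    (@wo_pow_le_refl T) (@wo_pow_le_anti T) (@wo_pow_le_trans T).
HB.instance Definition _ (T : Type) :=
  @Order.POrder_isTotal.Build wo_pow_display (wo_pow T) (@wo_pow_le_total T).

Definition csucc_sort (T : Type) : Type :=
  {x : wo_pow T | [set y | y < x] #<= [set: T]}.

Fact csucc_display : Order.disp_t. Proof. exact: Order.Disp tt tt. Qed.

HB.instance Definition _ (T : Type) := SubChoice.on (csucc_sort T).
HB.instance Definition _ (T : Type) :=
  [SubChoice_isSubOrder of csucc_sort T by <: with csucc_display].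

Lemma csucc_sort_well_order (T : Type) :
  well_order (<=%O : rel (csucc_sort T)).
Proof.
apply: antisymmetric_well_order; first exact: le_anti.
move=> A [a aA].
pose B := [pred x : wo_pow T | `[< exists2 u, u \in A & val u = x >]].
have [|x [[/asboolP[u uA <-] xmin] _]] :=
  svalP (well_ordering_principle (wo_pow T)) B.
  by exists (val a); apply/asboolP; exists a.
exists u; split => // v vA.
by apply: (xmin (val v)); apply/asboolP; exists v.
Qed.

Lemma csucc_sort_segment (T : Type) (x : csucc_sort T) :
  [set y | y < x] #<= [set: T].
Proof.
apply: card_le_trans (valP x).
have /injfunPex[f] :
    exists2 f : csucc_sort T -> wo_pow T,
      set_fun [set y | y < x] [set y | y < val x] f &
      set_inj [set y | y < x] f.
  by exists val => [y //|y z _ _]; apply: val_inj.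
exact: inj_card_le f.
Qed.

Lemma csucc_sort_gt (T : Type) : ~ ([set: csucc_sort T] #<= [set: T]).
Proof.
move=> leT.
have range_le (A : set (wo_pow T)) :
    A `<=` range (val : csucc_sort T -> wo_pow T) -> A #<= [set: T].
  move=> /subset_card_le /card_le_trans; apply.
  exact: card_le_trans (card_image_le _ _) leT.
have [allS|/existsNP[x0 /negP x0P]] :=
  pselect (forall x : wo_pow T, [set y | y < x] #<= [set: T]).
  have /card_leP[f] : [set: wo_pow T] #<= [set: T].
    by apply: range_le => x _; exists (exist _ x (allS x)).
  pose h (A : set T) : T := val (f (SigSub (mem_set (I : [set: wo_pow T] A)))).
  have h_inj : injective h.
    move=> A B /val_inj /(@inj _ _ _ f).
    by move=> /(_ (mem_set I) (mem_set I)) /(congr1 val).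
  pose D : set T := [set t | exists2 A : set T, h A = t & ~ A t].
  have DhD : ~ D (h D) by move=> DD; case: (DD) => A /h_inj ->; apply.
  by apply: (DhD); exists D.
pose B := [pred x : wo_pow T | ~~ ([set y | y < x] #<= [set: T])].
have [|x [[/negP xB xmin] _]] := svalP (well_ordering_principle (wo_pow T)) B.
  by exists x0.
apply: xB; apply: range_le => y /= yx.
have yS : [set z | z < y] #<= [set: T].
  by apply: contraTT (yx) => /(xmin y); rewrite -leNgt.
by exists (exist _ y yS).
Qed.

Lemma csucc_sort_initial (T : Type) (x : csucc_sort T) :
  [set y | y < x] #!= [set: csucc_sort T].
Proof.
apply/negP; rewrite card_eq_le => /andP[_ le].
exact/(@csucc_sort_gt T)/(card_le_trans le)/csucc_sort_segment.
Qed.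

Definition csucc (K : cardinal) : cardinal :=
  Cardinal (@csucc_sort_well_order K) (@csucc_sort_initial K).

(** ** Jensen's square *)

Section Club.
Context {d : Order.disp_t} {W : orderType d}.
Implicit Types (C : set W) (a b : W).

(** Zero is excluded; for it the conditions in [square] only say [C 0 = set0]. *)
Definition is_limit a : Prop :=
  (exists c, c < a) /\ (forall c, c < a -> exists2 e, c < e & e < a).

Definition limit_point C b : Prop :=
  (exists c, c < b) /\ (forall c, c < b -> exists2 e, C e & c < e < b).

Definition is_club C a : Prop :=
  [/\ C `<=` [set c | c < a],
      forall c, c < a -> exists2 e, C e & c <= e
    & forall b, b < a -> limit_point C b -> C b].

(** [C] is isomorphic to an initial segment of [V], i.e. to an ordinal
    at most the order type of [V]. *)
Definition otp_le C {d' : Order.disp_t} (V : orderType d') : Prop :=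
  exists f : {c : W | C c} -> V,
    (forall c e, (f c < f e) = (sval c < sval e)) /\
    (forall u v, range f u -> v < u -> range f v).

End Club.

Definition square (K : cardinal) : Prop :=
  exists C : csucc K -> set (csucc K),
    forall a, is_limit a ->
      [/\ is_club (C a) a,
          otp_le (C a) K
        & forall b, limit_point (C a) b -> C b = (C a `&` [set c | c < b])%classic].

(** ** Ladders *)

(** [None] is the added element [1]; the semilattice operation is
    [flat_top_join]. *)
Definition flat_top (X : Type) : Type := option X.
HB.instance Definition _ (X : choiceType) := Choice.on (flat_top X).

Section FlatTop.
Variable X : choiceType.
Implicit Types x y z : flat_top X.

Definition flat_top_le x y : bool := (x == y) || (y == None).
Definition flat_top_join x y : flat_top X := if x == y then x else None.

Fact flat_top_le_refl : reflexive flat_top_le.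
Proof. by move=> x; rewrite /flat_top_le eqxx. Qed.

Fact flat_top_le_anti : antisymmetric flat_top_le.
Proof.
move=> x y; rewrite /flat_top_le [y == x]eq_sym.
by case: eqVneq => //= _ /andP[/eqP-> /eqP].
Qed.

Fact flat_top_le_trans : transitive flat_top_le.
Proof.
move=> y x z; rewrite /flat_top_le => /predU1P[->//|/eqP->].
by rewrite [None == z]eq_sym orbb => ->; rewrite orbT.
Qed.

Fact flat_top_display : Order.disp_t. Proof. exact: Order.Disp tt tt. Qed.

HB.instance Definition _ :=
  @Order.Le_isPOrder.Build flat_top_display (flat_top X) flat_top_le
    flat_top_le_refl flat_top_le_anti flat_top_le_trans.

Fact flat_top_leUx x y z :
  (flat_top_join x y <= z) = (x <= z) && (y <= z).
Proof.
change (flat_top_le (flat_top_join x y) z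
  = flat_top_le x z && flat_top_le y z).
rewrite /flat_top_join /flat_top_le.
case: (eqVneq x y) => [->|xy]; first by rewrite andbb.
rewrite [None == z]eq_sym orbb; case: (eqVneq z None) => [|_]; rewrite ?orbT//.
rewrite !orbF; apply/esym/negP => /andP[/eqP xz /eqP yz].
by rewrite xz yz eqxx in xy.
Qed.

HB.instance Definition _ :=
  @Order.POrder_isJoinSemilattice.Build flat_top_display (flat_top X)
    flat_top_join flat_top_leUx.

End FlatTop.

Definition flat_top_free (k : nat) d (L : joinSemilatticeType d) : Prop :=
  ~ exists S : set L,
      (forall x y, S x -> S y -> S (x `|` y)) /\
      (exists f : flat_top 'I_k -> L,
         set_bij [set: flat_top 'I_k] S f /\ {morph f : x y / x `|` y}).

Definition is_ladder (m : nat) (K : cardinal) d (L : latticeType d) : Prop :=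
  [/\ inhabited L,
      flat_top_free m.+1 L
    & forall x : L, card_lt [set y | y <= x] [set: K]].

(* Main.v *)
Require Import Defs.
From HB Require Import structures.
From mathcomp Require Import all_boot all_order.
From mathcomp Require Import boolp classical_sets functions cardinality.
From mathcomp Require Import wochoice.

(** Induction on [n]. Let [Q] be an [(n+1, kappa)]-ladder of cardinality
    [lam = kappa^(+n)], together with a map [e : lam -> Q] such that each
    [{k | e k <= q}] is closed in [lam] and of cardinality [< kappa]. Walking
    along a square sequence on [lam^+] gives a [Q]-valued version [s] of
    Todorcevic's subadditive function [rho : [lam^+]^2 -> lam], with [e]
    applied to the order types: for [a <= b <= c],
      [s a c <= s a b \/ s b c]  and  [s a b <= s a c \/ s b c],
    and [{a | s a b <= q}] is closed of cardinality [< kappa]. Order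
    [lam^+ * Q] by [(a, q) <= (b, r)] iff [q <= r], [a <= b] and [s a b <= r].
    Joins come from subadditivity and meets from closedness. If elements
    [(a_i, q_i)] have all their pairwise joins equal to [(b, r)], at most one
    of them has [a_i < b], and the [q_i] of the others have all their pairwise
    joins equal to [r]; hence the order stays free of flat semilattices, with
    one more element allowed. The new map is [a |-> (a, 0)]. *)

Set Implicit Arguments.
Unset Strict Implicit.
Unset Printing Implicit Defensive.

Import Order.TTheory.

Local Open Scope classical_set_scope.
Local Open Scope card_scope.

(** * Cardinal arithmetic *)

Section Cardinality.
Implicit Types T U V : Type.

Lemma card_le_rel T U (A : set T) (B : set U) (R : T -> U -> Prop) :
  (forall x, A x -> exists2 y, B y & R x y) ->
  (forall x x' y, A x -> A x' -> R x y -> R x' y -> x = x') ->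
  A #<= B.
Proof.
move=> tot inj.
have /choice[f fP] : forall x : A, exists y : B, R (set_val x) (set_val y).
  move=> [x xA]; have [y By Rxy] := tot x (set_mem xA).
  by exists (SigSub (mem_set By)).
apply/card_leP/injfunPex; exists f => // -[x xA] [y yA] _ _ fxy.
apply: val_inj => /=.
have := fP (exist _ x xA); rewrite fxy => Rx.
exact: (inj _ _ _ (set_mem xA) (set_mem yA) Rx (fP (exist _ y yA))).
Qed.

Lemma card_le_fun T U (A : set T) (B : set U) (f : T -> U) :
  {homo f : x / A x >-> B x} -> {in A &, injective f} -> A #<= B.
Proof.
move=> fAB finj; apply: (@card_le_rel _ _ _ _ (fun x y => f x = y)).
  by move=> x /fAB Bfx; exists (f x).
by move=> x x' y Ax Ax' <- /esym; apply: finj; apply: mem_set.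
Qed.

Lemma card_le_funP T U (A : set T) (B : set U) : A !=set0 -> A #<= B ->
  exists2 f : T -> U, {homo f : x / A x >-> B x} & {in A &, injective f}.
Proof.
move=> [x0 Ax0] /card_leP[g].
(* Off [A] the value at [x0] is the default; this is why [A] is nonempty. *)
pose f x := if pselect (A x) is left Ax then set_val (g (SigSub (mem_set Ax)))
  else set_val (g (SigSub (mem_set Ax0))).
have fE x (Ax : A x) : f x = set_val (g (SigSub (mem_set Ax))).
  rewrite /f; case: pselect => // Ax'.
  by rewrite (Prop_irrelevance Ax Ax').
exists f => [x Ax|x y /set_mem Ax /set_mem Ay].
  by rewrite fE; apply: set_valP.
rewrite !fE => /val_inj/(@inj _ _ _ g) - /(_ (mem_set I) (mem_set I)).
by case.
Qed.

Lemma card_leX T T' U U' (A : set T) (B : set U) (A' : set T') (B' : set U') :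
  A #<= B -> A' #<= B' -> A `*` A' #<= B `*` B'.
Proof.
have [->|/set0P A0] := eqVneq A set0; first by rewrite set0X.
have [->|/set0P A'0] := eqVneq A' set0; first by rewrite setX0.
move=> /(card_le_funP A0)[f fAB finj] /(card_le_funP A'0)[g gAB ginj].
apply: (@card_le_fun _ _ _ _ (fun p => (f p.1, g p.2))).
  by move=> p [Ap1 Ap2]; split; [apply: fAB|apply: gAB].
move=> [a a'] [b b'] /set_mem[/= Aa Aa'] /set_mem[/= Ab Ab'] [].
move=> /(finj _ _ (mem_set Aa) (mem_set Ab)) ->.
by move=> /(ginj _ _ (mem_set Aa') (mem_set Ab')) ->.
Qed.

(** Zorn's lemma on partial bijections: if a maximal one missed a point on both sides, that pair
    could be added to it. *)
Lemma card_le_total T U (A : set T) (B : set U) : A #<= B \/ B #<= A.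
Proof.
pose P (G : set (T * U)) := G `<=` A `*` B /\
  forall p q, G p -> G q -> (p.1 = q.1 <-> p.2 = q.2).
have [|G [[GAB Gbij] Gmax]] := @Zorn_bigcup _ P.
  move=> F FP Ftot; split=> [p [X FX Xp]|p q [X FX Xp] [Y FY Yq]].
    by have [+ _] := FP _ FX; apply.
  have [XY|YX] := Ftot _ _ FX FY.
    by have [_] := FP _ FY; apply=> //; apply: XY.
  by have [_] := FP _ FX; apply=> //; apply: YX.
have [Atot|/existsNP[x /not_implyP[Ax /forallNP xG]]] :=
  pselect (forall x, A x -> exists y, G (x, y)).
  left; apply: (@card_le_rel _ _ _ _ (fun x y => G (x, y))) => [x Ax|].
    by have [y Gxy] := Atot _ Ax; exists y => //; have [] := GAB _ Gxy.
  by move=> x x' y _ _ Gx Gx'; have [_] := Gbij _ _ Gx Gx'; apply.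
have [Btot|/existsNP[y /not_implyP[By /forallNP yG]]] :=
  pselect (forall y, B y -> exists x, G (x, y)).
  right; apply: (@card_le_rel _ _ _ _ (fun y x => G (x, y))) => [y By|].
    by have [x' Gxy] := Btot _ By; exists x' => //; have [] := GAB _ Gxy.
  by move=> y y' x' _ _ Gy Gy'; have [+ _] := Gbij _ _ Gy Gy'; apply.
case: (Gmax (G `|` [set (x, y)])).
  split; first exact: subsetUl.
  by move=> /(_ (x, y) (or_intror erefl)); apply: xG.
split; first by move=> p [/GAB|->].
move=> [a b] [c d] [Gp|[-> ->]] [Gq|[-> ->]] //=; first exact: Gbij Gp Gq.
- by split=> e; [case: (xG b); rewrite -e|case: (yG a); rewrite -e].
- by split=> e; [case: (xG d); rewrite e|case: (yG c); rewrite e].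
Qed.

(** Two distinct points of [D] serve as tags: the first coordinate records which of the two sets the
    second one codes. *)
Lemma card_leU2 T U (A E : set T) (D : set U) (d0 d1 : U) :
  D d0 -> D d1 -> d0 <> d1 -> A #<= D -> E #<= D -> A `|` E #<= D `*` D.
Proof.
move=> Dd0 Dd1 d01.
have [->|/set0P A0] := eqVneq A set0.
  rewrite set0U => _ ED; apply: card_le_trans ED _.
  apply: (@card_le_fun _ _ _ _ (fun x => (x, x))) => // x y _ _ [] //.
have [->|/set0P E0] := eqVneq E set0.
  rewrite setU0 => AD _; apply: card_le_trans AD _.
  apply: (@card_le_fun _ _ _ _ (fun x => (x, x))) => // x y _ _ [] //.
move=> /(card_le_funP A0)[f fAD finj] /(card_le_funP E0)[g gED ginj].
apply: (@card_le_fun _ _ _ _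
  (fun x => if x \in A then (d0, f x) else (d1, g x))) => [x|x y].
  case: ifPn => [/set_mem Ax _|/negP xA [/mem_set//|Ex]].
    by split=> //; apply: fAD.
  by split=> //; apply: gED.
move=> /set_mem xAE /set_mem yAE.
case: ifPn => xA; case: ifPn => yA [].
- exact: finj.
- by [].
- by move=> /esym.
- case: xAE => [/mem_set|/mem_set xE]; first by rewrite (negPf xA).
  case: yAE => [/mem_set|/mem_set yE]; first by rewrite (negPf yA).
  exact: ginj.
Qed.

Lemma infinite_set_two T (A : set T) : infinite_set A ->
  exists x y, [/\ A x, A y & x <> y].
Proof.
move=> /infiniteP/(card_le_funP (ex_intro _ 0%N I))[f fA finj].
exists (f 0%N), (f 1%N); split; [exact: fA|exact: fA|].
by move=> /(finj _ _ (mem_set I) (mem_set I)).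
Qed.


(** Zorn's lemma on relations [G] that inject [D * D] into [D], where [D = fld G] is the range. For
    a maximal one [D] is as large as [A]: otherwise the complement of [D] in [A] contains a copy [B]
    of [D], and the pairs over the union of both that are not over [D] can be sent into [B]. *)
Lemma card_leXX T (A : set T) : infinite_set A -> A `*` A #<= A.
Proof.
move=> Ainf.
pose fld (G : set ((T * T) * T)) : set T := [set z | exists p, G (p, z)].
pose good G := [/\ fld G `<=` A,
  forall x y, fld G x -> fld G y -> exists z, G ((x, y), z) &
  forall p p' z, G (p, z) -> G (p', z) -> p = p'].
have good_le G : good G -> fld G `*` fld G #<= fld G.
  move=> [_ Gtot Ginj].
  apply: (@card_le_rel _ _ _ _ (fun p z => G (p, z))).
    by move=> [x y] [/= Gx Gy]; have [z Gz] := Gtot _ _ Gx Gy;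
      exists z => //; exists (x, y).
  by move=> p p' z _ _; apply: Ginj.
have [G0 [goodG0 G0inf]] : exists G0, good G0 /\ infinite_set (fld G0).
  have := Ainf; move=> /infiniteP/(card_le_funP (ex_intro _ 0%N I))[g gA ginj].
  have : [set: nat * nat] #<= [set: nat].
    by have /card_eqPle[] := card_nat2.
  move=> /(card_le_funP (ex_intro _ (0, 0)%N I))[c _ cinj].
  pose G0 : set ((T * T) * T) :=
    [set q | exists i j, q = ((g i, g j), g (c (i, j)))].
  exists G0; split; last first.
    apply/infiniteP; apply: (@card_le_fun _ _ _ _ (fun i => g (c (i, i)))).
      by move=> i _; exists (g i, g i), i, i.
    move=> i j _ _ /(ginj _ _ (mem_set I) (mem_set I)).
    by move=> /(cinj _ _ (mem_set I) (mem_set I)) [].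
  split.
  - by move=> z [p [i [j [_ ->]]]]; apply: gA.
  - move=> _ _ [_ [i [j [_ ->]]]] [_ [k [l [_ ->]]]].
    by exists (g (c (c (i, j), c (k, l)))), (c (i, j)), (c (k, l)).
  - move=> p p' z [i [j [-> ->]]] [k [l [->]]].
    move=> /(ginj _ _ (mem_set I) (mem_set I)).
    by move=> /(cinj _ _ (mem_set I) (mem_set I)) [-> ->].
(* [G0], a pairing function on a copy of the naturals, keeps the range infinite and takes care of
   the empty chain. *)
have [|G [goodG Gmax]] := @Zorn_bigcup _ (fun G => good (G0 `|` G)).
  move=> F FP Ftot; set H := _ `|` _.
  have HP u v : H u -> H v ->
      exists Z, [/\ good Z, Z `<=` H, Z u & Z v].
    move=> [G0u|[X FX Xu]] [G0v|[Y FY Yv]].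
    - by exists G0; split=> //; apply: subsetUl.
    - exists (G0 `|` Y); split; [exact: FP| |by left|by right].
      by apply: setUS => y Yy; exists Y.
    - exists (G0 `|` X); split; [exact: FP| |by right|by left].
      by apply: setUS => y Yy; exists X.
    - have [XY|YX] := Ftot _ _ FX FY.
        exists (G0 `|` Y); split; [exact: FP| |right; exact: XY|by right].
        by apply: setUS => y Yy; exists Y.
      exists (G0 `|` X); split; [exact: FP| |by right|right; exact: YX].
      by apply: setUS => y Yy; exists X.
  split.
  - move=> z [p Hp]; have [Z [[ZA _ _] _ Zp _]] := HP _ _ Hp Hp.
    by apply: ZA; exists p.
  - move=> x y [p Hp] [q Hq]; have [Z [[_ Ztot _] ZH Zp Zq]] := HP _ _ Hp Hq.
    have [||z Zz] := Ztot x y; [by exists p|by exists q|].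
    by exists z; apply: ZH.
  - move=> p p' z Hp Hp'; have [Z [[_ _ Zinj] _ Zp Zp']] := HP _ _ Hp Hp'.
    exact: Zinj Zp Zp'.
set H := G0 `|` G in goodG; set D := fld H.
have DD : D `*` D #<= D := good_le _ goodG.
have [DA Htot Hinj] := goodG.
have Dinf : infinite_set D.
  by apply: sub_infinite_set G0inf => z [p G0p]; exists p; left.
have [d0 [d1 [Dd0 Dd1 d01]]] := infinite_set_two Dinf.
have [AD|DAD] := card_le_total (A `\` D) D.
  have {}AD : A #<= D.
    apply: card_le_trans DD; rewrite -(setUIDK A D).
    apply: (card_leU2 Dd0 Dd1 d01) => //.
    by apply: subset_card_le => z [].
  apply: card_le_trans (card_leX AD AD) _.
  by apply: card_le_trans DD _; apply: subset_card_le.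
have [f fDA finj] := card_le_funP (ex_intro _ _ Dd0) DAD.
pose B := f @` D; pose D' := D `|` B.
have BD : B #= D by apply: inj_card_eq.
have /card_eqPle[BleD DleB] := BD.
have D'D : D' #<= D.
  by apply: card_le_trans DD; apply: (card_leU2 Dd0 Dd1 d01).
have D'0 : (D' `*` D') !=set0 by exists (d0, d0); split; left.
have : D' `*` D' #<= B.
  apply: card_le_trans (card_leX D'D D'D) _.
  exact: card_le_trans DD DleB.
move=> /(card_le_funP D'0)[g gB ginj].
have BnD z : B z -> ~ D z by move=> [x /fDA[_ ?] <-].
pose G' := G `|` [set q | [/\ D' q.1.1, D' q.1.2, ~ (D q.1.1 /\ D q.1.2)
  & q.2 = g q.1]].
have fb : B (f d0) by exists d0.
case: (Gmax G').
  split; first exact: subsetUl.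
  move=> sub; have Gq : G ((f d0, f d0), g (f d0, f d0)).
    apply: sub; right; split=> /=; [by right|by right| |by []].
    by move=> [/(BnD _ fb)].
  apply: (BnD (g (f d0, f d0))).
    by apply: gB; split; right.
  by exists (f d0, f d0); right.
have fldD' z : fld (G0 `|` G') z -> D' z.
  move=> [p [G0p|[Gp|[/= D1 D2 _ ->]]]].
  - by left; exists p; left.
  - by left; exists p; right.
  - by right; apply: gB.
split.
- move=> z /fldD' [/DA//|[x Dx <-]].
  by have [] := fDA _ Dx.
- move=> x y /fldD' D'x /fldD' D'y.
  have [[Dx Dy]|nD] := pselect (D x /\ D y).
    have [z Hz] := Htot _ _ Dx Dy; exists z.
    by case: Hz => [?|?]; [left|right; left].
  by exists (g (x, y)); right; right.
- have old p z : (G0 `|` G') (p, z) -> H (p, z) /\ D z \/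
      [/\ (D' `*` D') p, z = g p & ~ D z].
    move=> [G0p|[Gp|[/= D1 D2 _ ->]]].
    + by left; split; [left|exists p; left].
    + by left; split; [right|exists p; right].
    + by right; split=> //; apply: BnD; apply: gB.
  move=> p p' z /old[[Hp Dz]|[D'p zE nDz]] /old[[Hp' Dz']|[D'p' zE' nDz']] //.
    exact: Hinj Hp Hp'.
  by apply: ginj; rewrite ?inE -?zE.
Qed.

Lemma card_leU_infinite T U (A E : set T) (X : set U) :
  infinite_set X -> A #<= X -> E #<= X -> A `|` E #<= X.
Proof.
move=> Xinf AX EX; have [x [y [Xx Xy xy]]] := infinite_set_two Xinf.
exact: card_le_trans (card_leU2 Xx Xy xy AX EX) (card_leXX Xinf).
Qed.

Lemma card_le_finite_infinite T U (A : set T) (X : set U) :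
  finite_set A -> infinite_set X -> A #<= X.
Proof.
move=> Afin Xinf; have [//|XA] := card_le_total A X.
by case: Xinf; apply: card_le_finite Afin.
Qed.

Lemma card_lt_finite T U (A : set T) (K : set U) :
  infinite_set K -> finite_set A -> card_lt A K.
Proof.
move=> Kinf Afin; split; first exact: card_le_finite_infinite.
by apply/negP => /eq_finite_set e; apply: Kinf; rewrite -e.
Qed.

Lemma card_le_lt T U V (A : set T) (B : set U) (K : set V) :
  A #<= B -> card_lt B K -> card_lt A K.
Proof.
move=> AB [BK BnK]; split; first exact: card_le_trans BK.
apply/negP => /card_eqPle[_ KA]; move/negP: BnK; apply.
by apply/card_eqPle; split=> //; apply: card_le_trans AB.
Qed.

(** An infinite set absorbs its square, so the product is bounded by the larger factor unless both
    are finite. *)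
Lemma card_ltX T T' U (A : set T) (A' : set T') (K : set U) :
  infinite_set K -> card_lt A K -> card_lt A' K -> card_lt (A `*` A') K.
Proof.
move=> Kinf.
have main V V' (B : set V) (B' : set V') : B #<= B' -> card_lt B' K ->
    card_lt (B `*` B') K /\ card_lt (B' `*` B) K.
  move=> BB' B'K.
  have [B'fin|B'inf] := pselect (finite_set B').
    have Bfin : finite_set B by apply: card_le_finite B'fin.
    by split; apply: card_lt_finite => //; apply: finite_setX.
  by split; apply: card_le_lt B'K; (apply: card_le_trans (card_leXX B'inf));
    apply: card_leX.
move=> AK A'K; have [AA'|A'A] := card_le_total A A'.
  by have [] := main _ _ _ _ AA' A'K.
by have [] := main _ _ _ _ A'A AK.
Qed.

Lemma card_le_bigcup I T U (S : set I) (F : I -> set T) (X : set U) :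
  infinite_set X -> S #<= X -> (forall i, S i -> F i #<= X) ->
  \bigcup_(i in S) F i #<= X.
Proof.
move=> Xinf SX FX; have [x0 Xx0] := infinite_setN0 Xinf.
have [->|/set0P S0] := eqVneq S set0; first by rewrite bigcup_set0.
have [s sX sinj] := card_le_funP S0 SX.
have /choice[f fP] : forall i, exists f : T -> U, S i ->
    {homo f : x / F i x >-> X x} /\ {in F i &, injective f}.
  move=> i; have [Si|nSi] := pselect (S i); last by exists (fun=> x0).
  have [Fi0|/set0P Fi0] := eqVneq (F i) set0.
    by exists (fun=> x0) => _; rewrite Fi0; split=> // x y; rewrite in_set0.
  by have [f fX finj] := card_le_funP Fi0 (FX _ Si); exists f.
apply: card_le_trans (card_leXX Xinf).
apply: (@card_le_rel _ _ _ _
  (fun z p => exists i, [/\ S i, F i z, p.1 = s i & p.2 = f i z])).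
  move=> z [i Si Fiz]; exists (s i, f i z); last by exists i.
  by split; [apply: sX|have [+ _] := fP _ Si; apply].
move=> z z' p _ _ [i [Si Fiz -> ->]] [j [Sj Fjz' sij]].
have {}sij := sinj _ _ (mem_set Si) (mem_set Sj) sij; subst j.
by have [_] := fP _ Si; apply; apply: mem_set.
Qed.

End Cardinality.

Local Open Scope order_scope.

(** * Walks along a coherent sequence of clubs *)

Section WellOrder.
Context {d : Order.disp_t} {W : orderType d}.
Hypothesis W_wo : well_order (<=%O : rel W).

Lemma wo_min (A : set W) : A !=set0 ->
  exists2 x, A x & forall y, A y -> x <= y.
Proof.
move=> [a Aa]; have [|x [[xA xmin] _]] := W_wo (A := [pred x | x \in A]).
  by exists a; apply: mem_set.
exists x; first exact: set_mem.
by move=> y Ay; apply: xmin; apply: mem_set.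
Qed.

Lemma wo_ind (P : W -> Prop) :
  (forall x, (forall y, y < x -> P y) -> P x) -> forall x, P x.
Proof.
move=> Pind x; apply: contrapT => nPx.
have [|y nPy ymin] := @wo_min [set y | ~ P y]; first by exists x.
apply: nPy; apply: Pind => z zy; apply: contrapT => /ymin.
by rewrite leNgt zy.
Qed.

End WellOrder.

Section Walk.
Context {d dK dQ : Order.disp_t}.
Context {W : orderType d} {K : orderType dK} {Q : latticeType dQ}.
Hypothesis W_wo : well_order (<=%O : rel W).
Variables (C : W -> set W) (pos : W -> W -> K) (e : K -> Q).
Hypothesis C_lt : forall b c, C b c -> c < b.
Hypothesis C_cofinal : forall a b, a < b -> exists2 c, C b c & a <= c.
Hypothesis C_closed : forall a b, a < b -> limit_point (C b) a -> C b a.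
Hypothesis C_coherent : forall a b, limit_point (C b) a ->
  C a = (C b `&` [set c | c < a])%classic.
Hypothesis pos_lt : forall b c c', C b c -> C b c' ->
  (pos b c < pos b c') = (c < c').
Hypothesis pos_initial : forall b c v, C b c -> v < pos b c ->
  exists2 c', C b c' & pos b c' = v.
Hypothesis pos_coherent : forall a b c, limit_point (C b) a -> C a c ->
  pos a c = pos b c.

Variable k0 : K.
Hypothesis k0_min : forall k, k0 <= k.
Hypothesis e_k0 : forall q, e k0 <= q.
Hypothesis e_closed : forall q k,
  limit_point [set k | e k <= q] k -> e k <= q.

Definition cpred b p c :=
  [/\ C b p, p < c & forall x, C b x -> x < c -> x <= p].
(** The first step of the walk from [b] towards [a]. *)
Definition cnext b a m :=
  [/\ C b m, a <= m & forall x, C b x -> a <= x -> m <= x].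

Lemma cnext_exists a b : a < b -> exists m, cnext b a m.
Proof.
move=> /C_cofinal[c Cc ac].
have [|m [Cm am] mmin] := wo_min W_wo (A := [set x | C b x /\ a <= x]).
  by exists c.
by exists m; split=> // x Cx ax; apply: mmin.
Qed.

(** If [c] is neither the minimum nor a limit point, the supremum of the elements of [C b] below [c]
    is below [c]; outside [C b] it would be a limit point, against closedness. *)
Lemma cpred_or_limit b c : C b c ->
  [\/ forall x, C b x -> c <= x, exists p, cpred b p c | limit_point (C b) c].
Proof.
move=> Cc.
have [cmin|/existsNP[y0 /not_implyP[Cy0 /negP]]] :=
  pselect (forall x, C b x -> c <= x); first by constructor 1.
rewrite -ltNge => y0c.
have [lim|nlim] := pselect (limit_point (C b) c); first by constructor 3.
constructor 2.
have [x xc xC] : exists2 x, x < c & forall y, C b y -> y < c -> y <= x.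
  apply: contrapT => H; apply: nlim; split; first by exists y0.
  move=> x xc; apply: contrapT => H'; apply: H; exists x => // y Cy yc.
  rewrite leNgt; apply/negP => xy; apply: H'; exists y => //.
  by rewrite xy.
have [|s sC smin] := wo_min W_wo
    (A := [set u | forall y, C b y -> y < c -> y <= u]); first by exists x.
have sc : s < c by apply: le_lt_trans (smin _ xC) xc.
exists s; split=> //; apply: contrapT => nCs; apply: (nCs).
have ltE y : C b y -> y <= s -> y < s.
  by move=> Cy; rewrite le_eqVlt => /predU1P[ys|//]; rewrite -ys in nCs.
apply: C_closed; first exact: lt_trans sc (C_lt Cc).
split; first by exists y0; apply: ltE => //; apply: sC.
move=> v vs; apply: contrapT => H.
have : s <= v; last by rewrite leNgt vs.
apply: smin => y Cy yc; rewrite leNgt; apply/negP => vy; apply: H.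
by exists y => //; rewrite vy ltE // sC.
Qed.

(* For fixed [q] this is a tree order on [W] contained in [<=]; its index set
   [{q | reach q a b}] is the principal filter of [s a b]. A nonlimit element
   of [C b] is admitted only if its predecessor in [C b] is admitted and is
   related to it; by coherence nothing is needed at limit points. Only finitely
   many elements of [C b] separate a given one from the nearest limit point, so
   a finite join of conditions on [q] arises. *)
Inductive reach (q : Q) : W -> W -> Prop :=
| reach_refl b : reach q b b
| reach_in a b : C b a -> e (pos b a) <= q ->
    (forall p, cpred b p a -> reach q p b) ->
    (forall p, cpred b p a -> reach q p a) -> reach q a b
| reach_out a b m : ~ C b a -> cnext b a m -> a < b ->
    reach q a m -> reach q m b -> reach q a b.

Lemma reachE q a b : reach q a b -> [\/ a = b,
  [/\ C b a, e (pos b a) <= q &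
    forall p, cpred b p a -> reach q p b /\ reach q p a] |
  [/\ ~ C b a, a < b &
    exists m, [/\ cnext b a m, reach q a m & reach q m b]]].
Proof.
case=> [{}b|{}a {}b Ca eq H1 H2|{}a {}b m nC mP ab am mb].
- by constructor 1.
- by constructor 2; split=> // p pP; split; [apply: H1|apply: H2].
- by constructor 3; split=> //; exists m.
Qed.

Lemma reach_inE q a b : C b a -> reach q a b <->
  e (pos b a) <= q /\ forall p, cpred b p a -> reach q p b /\ reach q p a.
Proof.
move=> Ca; split; last by move=> [eq H]; apply: reach_in => // p /H[].
move=> /reachE[ab|[]//|[]//].
by move: Ca; rewrite ab => /C_lt; rewrite ltxx.
Qed.

Lemma reach_outE q a b m : ~ C b a -> a < b -> cnext b a m ->
  reach q a b <-> reach q a m /\ reach q m b.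
Proof.
move=> nCa ab [Cm am mmin]; split; last first.
  by move=> [ram rmb]; apply: (reach_out nCa _ ab ram rmb).
move=> /reachE[eab|[]//|[_ _ [m' [[Cm' am' m'min] ? ?]]]].
  by rewrite eab ltxx in ab.
suff -> : m = m' by [].
by apply/le_anti; rewrite mmin //= m'min.
Qed.

Lemma cnext_lt b a m : cnext b a m -> m < b.
Proof. by move=> [/C_lt]. Qed.

Lemma cpred_lt b p a : cpred b p a -> p < a.
Proof. by move=> []. Qed.

Lemma reach_le q a b : reach q a b -> a <= b.
Proof. by move=> /reachE[->//|[/C_lt/ltW]|[_ /ltW]]. Qed.

(** By coherence [C c] is an initial part of [C b] with the same positions and predecessors, so the
    recursions from [b] and from [c] agree below [c]. *)
Lemma reach_lim q a b c : limit_point (C b) c -> C b c -> a < c ->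
  reach q a b <-> reach q a c.
Proof.
move=> lim Cc.
have CE x : C c x <-> C b x /\ x < c by rewrite (C_coherent lim).
have cb := C_lt Cc.
have CcE x : x < c -> C c x <-> C b x.
  by move=> xc; rewrite CE; split=> [[]|].
have inP : forall x, C c x -> reach q x b <-> reach q x c.
  apply: (wo_ind W_wo) => x IH Cx.
  have xc := C_lt Cx.
  rewrite (reach_inE _ Cx) (reach_inE _ ((CcE _ xc).1 Cx)).
  rewrite -(pos_coherent lim Cx).
  have predE p : cpred b p x <-> cpred c p x.
    split=> [[Cp px H]|[Cp px H]].
      split=> //; first by apply/CcE => //; apply: lt_trans xc.
      by move=> y /CE[Cy _]; apply: H.
    split=> //; first by apply/CcE => //; apply: lt_trans xc.
    by move=> y Cy yx; apply: H => //; apply/CcE => //; apply: lt_trans xc.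
  have predIH p : cpred c p x -> reach q p b <-> reach q p c.
    by move=> pP; apply: IH; [apply: cpred_lt pP|case: pP].
  split=> -[eq H]; split=> // p.
    by move=> pP; have [rpb rpx] := H _ ((predE p).2 pP); rewrite -predIH.
  move=> /predE pP; have [rpc rpx] := H _ pP; by rewrite predIH.
move=> ac; have [/CcE Ca|nCa] := pselect (C b a); first exact: inP (Ca ac).
have [m mP] := cnext_exists ac.
have nCca : ~ C c a by move=> /CE[].
have mP' : cnext b a m.
  have mc := cnext_lt mP.
  case: mP => /CE[Cm _] am mmin; split=> // x Cx ax.
  have [xc|cx] := ltP x c; first by apply: mmin => //; apply/CE.
  exact: le_trans (ltW mc) cx.
rewrite (reach_outE q nCca ac mP) (reach_outE q nCa (lt_trans ac cb) mP').
by rewrite inP //; case: mP.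
Qed.

(** Both subadditivity inequalities for [s] at once. The induction is on [c] and, inside it, on [b]
    in [C c]; any other [b] is reduced to the first step [m] from [c] towards it. *)
Lemma reach_tree q c : forall a b, reach q b c -> a <= b ->
  reach q a b <-> reach q a c.
Proof.
move: c; apply: (wo_ind W_wo) => c IH.
have inP : forall b, C c b -> reach q b c -> forall a, a <= b ->
    reach q a b <-> reach q a c.
  apply: (wo_ind W_wo) => b IHb Cb rb a.
  rewrite le_eqVlt => /predU1P[->|ab].
    by split=> // _; apply: reach_refl.
  (* If [a] lies above all earlier elements of [C c], the first step from [c] towards [a] is [b]. *)
  have out p : (forall x, C c x -> x < b -> x <= p) -> p < a ->
      reach q a b <-> reach q a c.
    move=> pmax pa.
    have nCa : ~ C c a by move=> /pmax /(_ ab); rewrite leNgt pa.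
    have next : cnext c a b.
      split=> //; first exact: ltW.
      move=> x Cx ax; rewrite leNgt; apply/negP => /(pmax _ Cx) xp.
      by move: (le_trans ax xp); rewrite leNgt pa.
    by rewrite (reach_outE q nCa (lt_trans ab (C_lt Cb)) next); split=> [|[]].
  have [bmin|[p pP]|lim] := cpred_or_limit Cb.
  - have nCa : ~ C c a by move=> /bmin; rewrite leNgt ab.
    have next : cnext c a b.
      by split=> //; [apply: ltW|move=> x Cx _; apply: bmin].
    by rewrite (reach_outE q nCa (lt_trans ab (C_lt Cb)) next); split=> [|[]].
  - have [Cp pb pmax] := pP.
    have [_ /(_ _ pP)[rpc rpb]] := (reach_inE q Cb).1 rb.
    (* As [p] is related to both [b] and [c], for [a <= p] both sides are equivalent to
       [reach q a p]. *)
    have [ap|pa] := leP a p; last exact: out pmax pa.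
    by rewrite -(IH b (C_lt Cb) a p rpb ap) (IHb p pb Cp rpc a ap).
  - by rewrite (reach_lim q lim Cb ab).
move=> a b rb ab.
have [bc|[Cb _ _]|[nCb bc [m [mP rbm rmc]]]] := reachE rb.
- by rewrite bc.
- exact: inP.
- have [Cm bm _] := mP.
  rewrite (IH m (cnext_lt mP) a b rbm ab) (inP m Cm rmc) //.
  exact: le_trans bm.
Qed.

Lemma reach_trans q a b c : reach q a b -> reach q b c -> reach q a c.
Proof. by move=> ab bc; apply/(reach_tree bc) => //; apply: reach_le ab. Qed.

Lemma reach_least a b : a <= b -> exists s, forall q, reach q a b <-> s <= q.
Proof.
move: b a; apply: (wo_ind W_wo) => b IH.
have inP : forall a, C b a -> exists s, forall q, reach q a b <-> s <= q.
  apply: (wo_ind W_wo) => a IHa Ca.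
  (* Without a predecessor in [C b] the recursion ends: only the position of [a] matters. *)
  have [[p pP]|npP] := pselect (exists p, cpred b p a); last first.
    exists (e (pos b a)) => q; rewrite (reach_inE q Ca).
    by split=> [[]//|eq]; split=> // p pP; case: npP; exists p.
  have [Cp pa pmax] := pP.
  have [s sP] := IHa p pa Cp.
  have [t tP] := IH a (C_lt Ca) p (ltW pa).
  exists (e (pos b a) `|` (s `|` t)) => q; rewrite (reach_inE q Ca) !leUx.
  split=> [[-> /(_ _ pP)[/sP -> /tP ->]]//|/and3P[eq sq tq]].
  split=> // p' [Cp' p'a p'max].
  have -> : p' = p by apply/le_anti; rewrite pmax ?p'max.
  by split; [apply/sP|apply/tP].
move=> a; rewrite le_eqVlt => /predU1P[->|ab].
  (* Reflexivity imposes nothing on [q], so the value is the bottom of [Q]. *)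
  exists (e k0) => q; split=> _; [exact: e_k0|exact: reach_refl].
have [Ca|nCa] := pselect (C b a); first exact: inP.
have [m mP] := cnext_exists ab; have [Cm am _] := mP.
have [s sP] := inP _ Cm.
have [t tP] := IH m (C_lt Cm) a am.
exists (t `|` s) => q; rewrite (reach_outE q nCa ab mP) leUx.
by split=> [[/tP -> /sP ->]//|/andP[/tP ? /sP ?]].
Qed.

(** A walk towards the least point only uses the minima of the clubs; these have position [k0],
    whose code is the bottom of [Q]. *)
Lemma reach_bottom q a b : (forall x, a <= x) -> reach q a b.
Proof.
move=> amin; move: b; apply: (wo_ind W_wo) => b IH.
have inP m : C b m -> (forall x, C b x -> m <= x) -> reach q m b.
  move=> Cm mmin; apply/reach_inE => //; split=> [|p [Cp pm _]]; last first.
    by move: (mmin _ Cp); rewrite leNgt pm.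
  suff -> : pos b m = k0 by apply: e_k0.
  apply/le_anti; rewrite k0_min andbT leNgt; apply/negP => k0m.
  have [c Cc ck0] := pos_initial Cm k0m.
  by move: k0m; rewrite -ck0 pos_lt // ltNge mmin.
have := amin b; rewrite le_eqVlt => /predU1P[<-|ab]; first exact: reach_refl.
have [Ca|nCa] := pselect (C b a); first by apply: inP => // x _; apply: amin.
have [m mP] := cnext_exists ab; have [Cm _ mmin] := mP.
rewrite (reach_outE q nCa ab mP); split; first exact: IH (C_lt Cm).
by apply: inP => // x Cx; apply: mmin.
Qed.

(** If a related element of [C b] lies at or above [a], the tree property moves the question from
    [b] down to it. Otherwise such elements are cofinal in [a], so [a] is a limit point of [C b] and
    only its position has to be checked, by [e_closed]. *)
Lemma reach_closed q b : forall a, a <= b ->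
  limit_point [set x | reach q x b] a -> reach q a b.
Proof.
move: b; apply: (wo_ind W_wo) => b IH a.
rewrite le_eqVlt => /predU1P[-> _|ab lim]; first exact: reach_refl.
have [[c [Cc ac rcb]]|nc] :=
  pselect (exists c, [/\ C b c, a <= c & reach q c b]).
  apply: (reach_trans _ rcb); apply: (IH c (C_lt Cc) a ac).
  have [ne H] := lim; split=> // x xa; have [y ryb /andP[xy ya]] := H x xa.
  exists y; last by rewrite xy.
  by apply/(reach_tree rcb); rewrite // ltW // (lt_le_trans ya).
(* A related [y] is in [C b] or has its first step there; either element stays below [a] by [nc]. *)
have cof x : x < a -> exists c, [/\ C b c, reach q c b & x < c < a].
  move=> xa; have [_ /(_ x xa)[y ryb /andP[xy ya0]]] := lim.
  have ya c : C b c -> reach q c b -> y <= c -> x < c < a.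
    move=> Cc rcb yc; rewrite (lt_le_trans xy yc) ltNge; apply/negP => ac.
    by apply: nc; exists c.
  have [yb|[Cy _ _]|[_ _ [m [[Cm ym _] _ rmb]]]] := reachE ryb.
  - by move: (lt_trans ya0 ab); rewrite yb ltxx.
  - by exists y; split=> //; apply: ya.
  - by exists m; split=> //; apply: ya.
have limC : limit_point (C b) a.
  split; first by case: lim.
  by move=> x /cof[c [Cc _ xc]]; exists c.
have Ca := C_closed ab limC.
apply/reach_inE => //; split; last first.
  move=> p [Cp pa pmax]; have [c [Cc _ /andP[pc ca]]] := cof _ pa.
  by move: (pmax _ Cc ca); rewrite leNgt pc.
apply: e_closed; split.
  have [[x xa] _] := lim; have [c [Cc _ /andP[_ ca]]] := cof _ xa.
  by exists (pos b c); rewrite pos_lt.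
move=> v va; have [x Cx xv] := pos_initial Ca va.
move: va; rewrite -xv pos_lt // => xa.
have [c [Cc rcb /andP[xc ca]]] := cof _ xa.
exists (pos b c); last by rewrite !pos_lt // xc.
by have [] := (reach_inE q Cc).1 rcb.
Qed.

(** Every walk from [b] passes through a related element of [C b], and [pos b] injects these into
    the codes below [q]; induction on [b] then bounds a union of few small sets. *)
Lemma reach_card q b T (kap : set T) : infinite_set kap ->
  card_lt [set k | e k <= q] kap -> card_lt [set a | reach q a b] kap.
Proof.
move=> kinf elt; pose S b := [set c | C b c /\ reach q c b].
have SX b' : S b' #<= [set k | e k <= q].
  apply: (@card_le_fun _ _ _ _ (pos b')).
    by move=> c [Cc /(reach_inE q Cc)[]].
  move=> c c' /set_mem[Cc _] /set_mem[Cc' _] cc'.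
  apply/le_anti; rewrite !leNgt; apply/andP; split; apply/negP.
    by rewrite -(pos_lt Cc' Cc) cc' ltxx.
  by rewrite -(pos_lt Cc Cc') cc' ltxx.
have reachS b' : [set a | reach q a b'] `<=`
    ([set b'] `|` \bigcup_(c in S b') [set a | reach q a c])%classic.
  move=> a /= rab.
  have [->|[Ca _ _]|[_ _ [m [[Cm _ _] ram rmb]]]] := reachE rab.
  - by left.
  - by right; exists a; [split|apply: reach_refl].
  - by right; exists m; [split|].
(* An infinite bound is preserved by such unions; in the finite case only finiteness is, which
   suffices since [kap] is infinite. *)
have [efin|einf] := pselect (finite_set [set k | e k <= q]).
  apply: card_lt_finite => //.
  move: b; apply: (wo_ind W_wo) => b IH; apply: sub_finite_set (reachS b) _.
  rewrite finite_setU; split; first exact: finite_set1.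
  apply: bigcup_finite; first exact: card_le_finite (SX b) efin.
  by move=> c [/C_lt/IH].
apply: card_le_lt elt.
move: b; apply: (wo_ind W_wo) => b IH.
apply: card_le_trans (subset_card_le (reachS b)) _.
apply: card_leU_infinite => //.
  exact: card_le_finite_infinite (finite_set1 b) einf.
by apply: card_le_bigcup => // c [/C_lt/IH].
Qed.

End Walk.

(** * The stepping-up of ladders *)

(** The carrier of [L] is [T] and [f] is the identity; the bijection gives access to the packed
    structure. *)
Lemma lattice_of_le (T : Type) (le : T -> T -> Prop) :
  (forall x, le x x) -> (forall x y, le x y -> le y x -> x = y) ->
  (forall x y z, le x y -> le y z -> le x z) ->
  (forall x y, exists z, forall t, le z t <-> le x t /\ le y t) ->
  (forall x y, exists z, forall t, le t z <-> le t x /\ le t y) ->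
  exists d (L : latticeType d) (f : L -> T), bijective f /\
    forall x y : L, (x <= y) <-> le (f x) (f y).
Proof.
move=> lexx le_asym le_tr join_ex meet_ex.
pose leb x y := `[< le x y >].
have leb_refl : reflexive leb by move=> x; apply/asboolP.
have leb_anti : antisymmetric leb.
  by move=> x y /andP[/asboolP xy /asboolP yx]; apply: le_asym.
have leb_trans : transitive leb.
  by move=> y x z /asboolP xy /asboolP yz; apply/asboolP; apply: le_tr yz.
have /choice[j jP] : forall p : T * T, exists z, forall t,
  le z t <-> le p.1 t /\ le p.2 t by move=> [x y]; apply: join_ex.
have /choice[m mP] : forall p : T * T, exists z, forall t,
  le t z <-> le t p.1 /\ le t p.2 by move=> [x y]; apply: meet_ex.
have lexI x y z : leb x (m (y, z)) = leb x y && leb x z.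
  apply/asboolP/andP => [/mP[]|[/asboolP xy /asboolP xz]].
    by split; apply/asboolP.
  by apply/mP.
have leUx x y z : leb (j (x, y)) z = leb x z && leb y z.
  apply/asboolP/andP => [/jP[]|[/asboolP xz /asboolP yz]].
    by split; apply/asboolP.
  by apply/jP.
pose E := gen_eqMixin T.
pose Ch := gen_choiceMixin T.
pose CT : choiceType := HB.pack T E Ch.
pose P := Order.Le_isPOrder.Build wo_pow_display CT leb_refl leb_anti leb_trans.
pose PT : porderType wo_pow_display := HB.pack T E Ch P.
pose L := Order.POrder_MeetJoin_isLattice.Build wo_pow_display PT
  lexI leUx.
pose LT : latticeType wo_pow_display := HB.pack T E Ch P L.
exists wo_pow_display, LT, id; split; first by exists id.
by move=> x y; split=> [/asboolP|xy]; last apply/asboolP.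
Qed.

(** With at least two indices every [x i] is below [t], and two equal values would equal their join
    [t]; so such a family already is an embedding. *)
Lemma flat_top_freeP k d (L : latticeType d) : flat_top_free k.+2 L <->
  ~ exists (x : 'I_k.+2 -> L) t,
      (forall i, x i <> t) /\ forall i j, i != j -> x i `|` x j = t.
Proof.
split=> free.
  move=> [x [t [xt xU]]]; apply: free.
  pose f (u : flat_top 'I_k.+2) : L := if u is Some i then x i else t.
  have x_inj i j : x i = x j -> i = j.
    move=> xij; apply: contrapT => /eqP ij; apply: (xt i).
    by rewrite -(xU _ _ ij) -xij joinxx.
  have xt_le i : x i <= t.
    have [j ji] : exists j : 'I_k.+2, i != j.
      by have [->|?] := eqVneq i ord0; [exists ord_max|exists ord0].
    by rewrite -(xU _ _ ji) leUl.
  have fU : {morph f : u v / u `|` v}.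
    move=> [i|] [j|] /=.
    - have [->|ij] := eqVneq i j.
        by rewrite [in RHS]joinxx joinxx.
      rewrite xU //.
      suff -> : (Some i : flat_top 'I_k.+2) `|` Some j = None by [].
      by rewrite /Order.join /= /flat_top_join (inj_eq Some_inj) (negPf ij).
    - by rewrite (join_r (xt_le i)).
    - by rewrite (join_l (xt_le j)).
    - by rewrite joinxx.
  exists (range f); split.
    by move=> _ _ [u _ <-] [v _ <-]; exists (u `|` v) => //; rewrite fU.
  exists f; split=> //; split=> //.
  move=> [i|] [j|] _ _ //= fij.
  - by rewrite (x_inj _ _ fij).
  - by case: (xt _ fij).
  - by case: (xt _ (esym fij)).
move=> [S [_ [f [[_ finj _] fU]]]]; apply: free.
exists (fun i => f (Some i)), (f None); split.
  by move=> i /(finj _ _ (mem_set I) (mem_set I)).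
move=> i j ij; rewrite -fU; congr f.
by rewrite /Order.join /= /flat_top_join (inj_eq Some_inj) (negPf ij).
Qed.

(** * The lattice order on [W * Q], with [R q a b] read as [s a b <= q] *)

Section Product.
Context {d dQ : Order.disp_t} {W : orderType d} {Q : latticeType dQ}.
Hypothesis W_wo : well_order (<=%O : rel W).
Variables (R : Q -> W -> W -> Prop) (w0 : W).
Hypothesis R_refl : forall q a, R q a a.
Hypothesis R_le : forall q a b, R q a b -> a <= b.
Hypothesis R_tree : forall q a b c, R q b c -> a <= b -> R q a b <-> R q a c.
Hypothesis R_least : forall a b, a <= b ->
  exists s, forall q, R q a b <-> s <= q.
Hypothesis R_bottom : forall q b, R q w0 b.
Hypothesis R_closed : forall q a b, a <= b ->
  limit_point [set x | R q x b] a -> R q a b.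

Definition prod_le (x y : W * Q) := x.2 <= y.2 /\ R y.2 x.1 y.1.

Lemma R_mono q q' a b : q <= q' -> R q a b -> R q' a b.
Proof.
move=> qq' rab; have [s sP] := R_least (R_le rab).
by apply/sP; apply: le_trans qq'; apply/sP.
Qed.

Lemma R_trans q a b c : R q a b -> R q b c -> R q a c.
Proof. by move=> ab bc; apply/(R_tree bc) => //; apply: R_le ab. Qed.

(** The supremum of the common lower points is one of them: otherwise it is a limit of them, and
    both sets are closed. It becomes the first coordinate of a meet. *)
Lemma common_max q q' a b : exists m, [/\ R q m a, R q' m b &
  forall c, R q c a -> R q' c b -> c <= m].
Proof.
have [|s sub smin] := wo_min W_wo
    (A := [set u | forall c, R q c a -> R q' c b -> c <= u]).
  by exists a => c /R_le.
have leS v : v < s -> exists2 c, R q c a /\ R q' c b & v < c.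
  move=> vs; apply: contrapT => H; have : s <= v; last by rewrite leNgt vs.
  apply: smin => c ca cb; rewrite leNgt; apply/negP => vc.
  by apply: H; exists c.
exists s; suff [sa sb] : R q s a /\ R q' s b by split.
apply: contrapT => nS.
have ltS c : R q c a -> R q' c b -> c < s.
  move=> ca cb; rewrite lt_neqAle sub // andbT; apply/eqP => cs.
  by apply: nS; rewrite -cs.
have ne : exists c, c < s by exists w0; apply: ltS.
apply: nS; split; apply: R_closed.
- by apply: smin => c /R_le.
- by split=> // v /leS[c [ca cb] vc]; exists c; rewrite // vc ltS.
- by apply: smin => c _ /R_le.
- by split=> // v /leS[c [ca cb] vc]; exists c; rewrite // vc ltS.
Qed.

(** Once [R t b c] holds, the tree property makes [R t a c] equivalent to [R t a b], so the join
    keeps the larger first coordinate and absorbs [s] into the second. *)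
Lemma prod_join_le (x y : W * Q) : x.1 <= y.1 -> exists z,
  z.1 = y.1 /\ forall t, prod_le z t <-> prod_le x t /\ prod_le y t.
Proof.
case: x y => [a q] [b r] /= ab; have [s sP] := R_least ab.
exists (b, q `|` r `|` s); split=> // -[c t]; rewrite /prod_le /= !leUx.
split=> [[/andP[/andP[qt rt] st] rbc]|[[qt rac] [rt rbc]]].
  by split; split=> //; apply: R_trans rbc; apply/sP.
split=> //; rewrite qt rt /=; apply/sP.
exact/(R_tree rbc).
Qed.

Lemma prod_lattice : exists d (L : latticeType d) (f : L -> W * Q),
  bijective f /\ forall x y : L, x <= y <-> prod_le (f x) (f y).
Proof.
apply: lattice_of_le.
- by move=> x; split.
- move=> [a q] [b r] [/= qr /R_le ab] [/= rq /R_le ba].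
  by congr (_, _); apply/le_anti; rewrite ?ab ?ba ?qr ?rq.
- move=> [a q] [b r] [c t] [/= qr rab] [/= rt rbc].
  split=> /=; first exact: le_trans rt.
  by apply: R_trans rbc; apply: R_mono rab.
- move=> x y; have [xy|yx] := leP x.1 y.1.
    by have [z [_ zP]] := prod_join_le xy; exists z.
  have [z [_ zP]] := prod_join_le (ltW yx); exists z => t.
  by rewrite zP; split=> -[].
- move=> [a q] [b r]; have [m [ma mb mmax]] := common_max q r a b.
  exists (m, q `&` r) => -[c t]; rewrite /prod_le /= lexI.
  split=> [[/andP[tq tr] rcm]|[[tq rca] [tr rcb]]].
    split; split=> //.
      by apply: R_trans ma; apply: R_mono rcm; apply: leIl.
    by apply: R_trans mb; apply: R_mono rcm; apply: leIr.
  rewrite tq tr; split=> //.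
  (* Relatedness at [q] and at [r] gives it at their meet, as the admissible indices form a
     principal filter. *)
  have cm := mmax _ rca rcb; have [s sP] := R_least cm.
  apply/sP; rewrite lexI; apply/andP; split; apply/sP.
    exact/(R_tree ma).
  exact/(R_tree mb).
Qed.

Lemma prod_flat_top_free k d' (L : latticeType d') (f : L -> W * Q) :
  bijective f -> (forall x y : L, x <= y <-> prod_le (f x) (f y)) ->
  flat_top_free k.+2 Q -> flat_top_free k.+3 L.
Proof.
move=> [g fK gK] leE; rewrite !flat_top_freeP => free [x [t [xt xU]]].
apply: free.
have xt_le i : x i <= t.
  have [j ji] : exists j, i != j.
    by have [->|?] := eqVneq i ord0; [exists ord_max|exists ord0].
  by rewrite -(xU _ _ ji) leUl.
have top1 i j : i != j -> (f (x i)).1 <= (f (x j)).1 ->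
    (f t).1 <= (f (x j)).1.
  move=> ij /prod_join_le[z [<- zP]].
  have := (zP z).1 (conj (lexx _) (R_refl _ _)).
  rewrite -[z]gK -!leE => /andP; rewrite -leUx xU //.
  by rewrite leE => -[_ /R_le]; rewrite gK.
(* By [top1] two elements cannot both have a first coordinate strictly below that of [t]; [i0] is
   the exception, or arbitrary if there is none. *)
have [i0 i0P] : exists i0, forall j, j != i0 -> (f (x j)).1 = (f t).1.
  have x1 i : (f (x i)).1 <= (f t).1.
    by have := xt_le i; rewrite leE => -[_ /R_le].
  have [[i it]|H] := pselect (exists i, (f (x i)).1 < (f t).1).
    exists i => j ji; apply/le_anti; rewrite x1 /=.
    have [ij|ji'] := leP (f (x i)).1 (f (x j)).1.
      by apply: top1 ij; rewrite eq_sym.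
    by have := top1 _ _ ji (ltW ji'); rewrite leNgt it.
  exists ord0 => j _; apply/le_anti; rewrite x1 /= leNgt; apply/negP => jt.
  by apply: H; exists j.
pose y j := x (lift i0 j).
have y1 j : (f (y j)).1 = (f t).1 by apply: i0P; rewrite eq_sym neq_lift.
exists (fun j => (f (y j)).2), (f t).2; split.
  move=> i e; apply: (xt (lift i0 i)); apply: (can_inj fK).
  by rewrite (surjective_pairing (f t)) -e -(y1 i) -surjective_pairing.
move=> i j ij; apply/le_anti; rewrite leUx.
have y2 i' : (f (y i')).2 <= (f t).2.
  by have := xt_le (lift i0 i'); rewrite leE => -[].
rewrite !y2 /=.
(* An upper bound of [y i] and [y j] whose second coordinate is just the join; [t <= z] gives the
   missing inequality. *)
pose z := g ((f t).1, (f (y i)).2 `|` (f (y j)).2).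
have : t <= z; last by rewrite leE gK => -[].
rewrite -(xU (lift i0 i) (lift i0 j)) ?(inj_eq lift_inj) // leUx.
by apply/andP; split; rewrite leE gK /prod_le /= y1 ?leUl ?leUr; split.
Qed.

Lemma prod_ideal_card d' (L : latticeType d') (f : L -> W * Q) T (K : set T) :
  bijective f -> (forall x y : L, x <= y <-> prod_le (f x) (f y)) ->
  infinite_set K -> (forall q b, card_lt [set a | R q a b] K) ->
  (forall q : Q, card_lt [set r | r <= q] K) ->
  forall x : L, card_lt [set y | y <= x] K.
Proof.
move=> fbij leE Kinf Rlt Qlt x.
apply: (card_le_lt _ (card_ltX Kinf (Rlt (f x).2 (f x).1) (Qlt (f x).2))).
apply: (@card_le_fun _ _ _ _ f) => [y /leE[]//|].
by move=> y z _ _; apply: bij_inj.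
Qed.

End Product.

(** * From a square sequence to the data of the walks *)

(* A square sequence extended to successors by [C (a + 1) = {a}], where [pos b]
   is the collapse of [C b] onto its order type. *)
Definition square_data (K W : cardinal) (C : W -> set W) (pos : W -> W -> K) :=
  [/\ forall b c, C b c -> c < b,
      forall a b, a < b -> exists2 c, C b c & a <= c,
      forall a b, a < b -> limit_point (C b) a -> C b a,
      forall a b, limit_point (C b) a ->
        C a = (C b `&` [set c | c < a])%classic &
   [/\ forall b c c', C b c -> C b c' -> (pos b c < pos b c') = (c < c'),
      forall b c v, C b c -> v < pos b c -> exists2 c', C b c' & pos b c' = v &
      forall a b c, limit_point (C b) a -> C a c -> pos a c = pos b c]].

Lemma otp_le_pos d (W : orderType d) (C : set W) d' (V : orderType d')
    (v0 : V) :
  otp_le C V -> exists p : W -> V,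
    (forall c c', C c -> C c' -> (p c < p c') = (c < c')) /\
    (forall c v, C c -> v < p c -> exists2 c', C c' & p c' = v).
Proof.
move=> [f [flt finit]].
pose p c := if pselect (C c) is left h then f (exist _ c h) else v0.
have pE c (h : C c) : p c = f (exist _ c h).
  by rewrite /p; case: pselect => // h'; rewrite (Prop_irrelevance h h').
exists p; split=> [c c' Cc Cc'|c v Cc]; first by rewrite !pE flt.
rewrite pE => vc.
have [[c' Cc'] _ <-] := finit _ _ (ex_intro2 _ _ (exist _ c Cc) I erefl) vc.
by exists c' => //; rewrite pE.
Qed.

Lemma square_data_exists (K : cardinal) (k0 : K) :
  (forall k, k0 <= k) -> square K ->
  exists (C : csucc K -> set (csucc K)) (pos : csucc K -> csucc K -> K),
    square_data C pos.
Proof.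
move=> k0_min [C0 C0P]; set W := csucc K.
pose C (a : W) : set W := [set c | (is_limit a /\ C0 a c) \/
  (~ is_limit a /\ c < a /\ forall x, x < a -> x <= c)].
have C_limit a : is_limit a -> C a = C0 a.
  by move=> la; apply/seteqP; split=> c; [move=> [[]|[]]//|left].
have C_nlimit a : ~ is_limit a ->
    C a = [set c | c < a /\ forall x, x < a -> x <= c].
  by move=> la; apply/seteqP; split=> c; [move=> [[]|[]]//|right].
have lim_limit (A : set W) a : limit_point A a -> is_limit a.
  by move=> [ne H]; split=> // c /H[x _ /andP[]]; exists x.
have C_lt b c : C b c -> c < b.
  by move=> [[/C0P[[H _ _] _ _] /H]|[_ []]].
(* At a nonlimit [C b] has at most one element, hence no limit points. *)
have lim_nlim a b : limit_point (C b) a -> is_limit b.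
  move=> [[x xa] H]; apply: contrapT => nb.
  have [y Cy /andP[_ ya]] := H _ xa; have [z Cz /andP[yz _]] := H _ ya.
  move: Cy Cz; rewrite C_nlimit // => -[_ ymax] [zb _].
  by move: (ymax _ zb); rewrite leNgt yz.
have C_cof a b : a < b -> exists2 c, C b c & a <= c.
  move=> ab; have [lb|nb] := pselect (is_limit b).
    by rewrite C_limit //; have [[_ + _] _ _] := C0P _ lb; apply.
  rewrite C_nlimit //.
  have [c cb cmax] : exists2 c, c < b & forall x, x < b -> x <= c.
    apply: contrapT => H; apply: nb; split; first by exists a.
    move=> c cb; apply: contrapT => H'; apply: H; exists c => // x xb.
    by rewrite leNgt; apply/negP => cx; apply: H'; exists x.
  by exists c; [split|apply: cmax].
have C_closed a b : a < b -> limit_point (C b) a -> C b a.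
  move=> ab lim; have lb := lim_nlim _ _ lim; move: lim; rewrite C_limit //.
  by have [[_ _ +] _ _] := C0P _ lb; apply.
have C_coh a b : limit_point (C b) a -> C a = (C b `&` [set c | c < a])%classic.
  move=> lim; have lb := lim_nlim _ _ lim; have la := lim_limit _ _ lim.
  by move: lim; rewrite !C_limit //; have [_ _] := C0P _ lb; apply.
have /choice[pos posP] : forall b, exists p : W -> K,
    (forall c c', C b c -> C b c' -> (p c < p c') = (c < c')) /\
    (forall c v, C b c -> v < p c -> exists2 c', C b c' & p c' = v).
  move=> b; have [lb|nb] := pselect (is_limit b).
    by rewrite C_limit //; have [_ + _] := C0P _ lb; apply: otp_le_pos.
  (* The least position makes the image of a singleton an initial segment. *)
  exists (fun=> k0); rewrite C_nlimit //; split.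
    move=> c c' [cb cmax] [cb' cmax'].
    by have -> : c = c'; [apply/le_anti; rewrite cmax' ?cmax|rewrite !ltxx].
  by move=> c v _; rewrite ltNge k0_min.
exists C, pos; split=> //; split.
- by move=> b; have [] := posP b.
- by move=> b; have [] := posP b.
(* At a first disagreement the smaller value would already be taken by an earlier element, where
   both positions agree. *)
- move=> a b c lim; move: c; apply: (wo_ind (@card_well_order W)) => c IH Ca.
  have CE x : C a x <-> C b x /\ x < a by rewrite (C_coh _ _ lim).
  have [Cb ca] := (CE c).1 Ca.
  have [alt ainit] := posP a; have [blt binit] := posP b.
  have [h|h|//] := ltgtP (pos a c) (pos b c).
    have [x Cx e] := binit _ _ Cb h; move: h; rewrite -e blt // => xc.
    have Cax : C a x by apply/CE; split=> //; apply: lt_trans ca.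
    by move: (xc); rewrite -alt // IH // e ltxx.
  have [x Cx e] := ainit _ _ Ca h; move: h; rewrite -e alt // => xc.
  have [Cbx _] := (CE x).1 Cx.
  by move: (xc); rewrite -blt // -IH // e ltxx.
Qed.

(** * Induction along the successor cardinals *)

(* [e] codes the ordinals below [lam] by elements of the ladder; closedness of
   [{k | e k <= q}] is what makes the order built at the next cardinal have
   meets. *)
Definition coded_ladder n (kappa lam : cardinal) := exists d (L : latticeType d)
    (e : lam -> L),
  [/\ is_ladder n.+1 kappa L, [set: L] #= [set: lam],
    forall q, card_lt [set k | e k <= q] [set: kappa],
    forall q k, limit_point [set k | e k <= q] k -> e k <= q &
    forall k0, (forall k, k0 <= k) -> forall q, e k0 <= q].

(** The chain [kappa] coded by the identity: in a chain a join is one of its arguments, and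
    initiality of [kappa] makes the principal ideals small. *)
Lemma coded_ladder_base (kappa : cardinal) : infinite_set [set: kappa] ->
  coded_ladder 0 kappa kappa.
Proof.
move=> kinf; exists (card_disp kappa), kappa, id.
have ideal_lt (x : kappa) : card_lt [set y | y <= x] [set: kappa].
  split; first exact: card_leT.
  apply/negP => /card_eqPle[_ kx].
  have segK : [set y | y <= x] `<=` ([set y | y < x] `|` [set x])%classic.
    by move=> y /=; rewrite le_eqVlt => /predU1P[->|]; [right|left].
  have [segfin|seginf] := pselect (finite_set [set y | y < x]).
    apply: kinf; apply: card_le_finite kx _; apply: sub_finite_set segK _.
    by rewrite finite_setU; split=> //; apply: finite_set1.
  move/negP: (card_initial x); apply; apply/card_eqPle; split.
    exact: card_leT.
  apply: card_le_trans kx _; apply: card_le_trans (subset_card_le segK) _.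
  apply: card_leU_infinite => //.
  exact: card_le_finite_infinite (finite_set1 x) seginf.
split=> //.
- split=> //; first by have [k _] := infinite_setN0 kinf.
  apply/flat_top_freeP => -[x [t [xt xU]]].
  have := xU ord0 ord_max isT.
  by case: leP => _ /xt.
- move=> q k [_ H]; rewrite leNgt; apply/negP => /H[k' k'q /andP[qk' _]].
  by move: k'q; rewrite /= leNgt qk'.
Qed.

Lemma csucc_infinite (K : cardinal) :
  infinite_set [set: K] -> infinite_set [set: csucc K].
Proof.
move=> Kinf; have [|] := card_le_total [set: csucc K] [set: K].
  by move=> /csucc_sort_gt.
by move=> KS Sfin; apply: Kinf; apply: card_le_finite Sfin.
Qed.

Lemma coded_ladder_step n (kappa lam : cardinal) :
  infinite_set [set: kappa] -> infinite_set [set: lam] -> square lam ->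
  coded_ladder n kappa lam -> coded_ladder n.+1 kappa (csucc lam).
Proof.
move=> kinf linf sq [dQ [Q [e [[_ Qfree Qlt] Qcard elt eclosed ebot]]]].
set W := csucc lam; have W_wo := @card_well_order W.
have [x0 _] := infinite_setN0 linf.
have [|k0 _ k0_min'] := wo_min (@card_well_order lam) (A := setT).
  by exists x0.
have k0_min k : k0 <= k by apply: k0_min'.
have e_k0 q : e k0 <= q by apply: ebot.
have Winf := csucc_infinite linf.
have [y0 _] := infinite_setN0 Winf.
have [|w0 _ w0_min'] := wo_min W_wo (A := setT); first by exists y0.
have w0_min k : w0 <= k by apply: w0_min'.
have [C [pos [C_lt C_cof C_closed C_coh [pos_lt pos_init pos_coh]]]] :=
  square_data_exists k0_min sq.
pose R := reach C pos e.
have R_refl q a : R q a a by apply: reach_refl.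
have R_le q a b : R q a b -> a <= b := @reach_le _ _ _ _ _ _ _ _ _ C_lt q a b.
have R_tree q a b c : R q b c -> a <= b -> R q a b <-> R q a c.
  exact: reach_tree.
have R_least a b : a <= b -> exists s, forall q, R q a b <-> s <= q.
  exact: (reach_least W_wo pos C_lt C_cof e_k0).
have R_bottom q b : R q w0 b.
  exact: (reach_bottom W_wo C_lt C_cof pos_lt pos_init k0_min e_k0 q b w0_min).
have R_closed q a b : a <= b -> limit_point [set x | R q x b] a -> R q a b.
  exact: reach_closed.
have R_card q b : card_lt [set a | R q a b] [set: kappa].
  exact: reach_card.
have [d' [L [f [fbij leE]]]] :=
  prod_lattice W_wo R_refl R_le R_tree R_least R_bottom R_closed.
have [g fK gK] := fbij.
(* This turns the size and closedness conditions on the new codes into [R_card] and [R_closed]. *)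
have ideal' (x : L) :
    [set a | g (a, e k0) <= x] = [set a | R (f x).2 a (f x).1].
  apply/seteqP; split=> a /=; rewrite leE gK; first by case.
  by move=> ra; split; first exact: e_k0.
exists d', L, (fun a => g (a, e k0)); split.
- split; first by constructor; exact: (g (w0, e k0)).
    exact: prod_flat_top_free fbij leE Qfree.
  exact: prod_ideal_card fbij leE kinf R_card Qlt.
- apply/card_eqPle; split.
    apply: card_le_trans (card_leXX Winf).
    have QW : [set: Q] #<= [set: W].
      have /card_eqPle[Qlam _] := Qcard; apply: card_le_trans Qlam _.
      have [//|/csucc_sort_gt//] := card_le_total [set: lam] [set: W].
    apply: card_le_trans (card_leX (card_lexx [set: W]) QW).
    apply: (@card_le_fun _ _ _ _ f) => // x y _ _; exact: bij_inj.
  apply: (@card_le_fun _ _ _ _ (fun a => g (a, e k0))) => // a b _ _.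
  by move=> /(can_inj gK)[].
- by move=> q; rewrite ideal'.
- move=> q a; rewrite ideal' => lim.
  have : R (f q).2 a (f q).1;
    last by rewrite -[R _ _ _]/([set a | _] a) -ideal'.
  (* All points related to the first coordinate of [f q] are at most it, hence so is their limit
     point. *)
  apply: R_closed => //; rewrite leNgt; apply/negP => /(proj2 lim)[x /R_le xf].
  by rewrite (ltNge _ x) xf.
- move=> a amin q; rewrite leE gK; split; first exact: e_k0.
  suff -> : a = w0 by [].
  by apply/le_anti; rewrite amin w0_min.
Qed.

Theorem theorem1p3 (kappa : cardinal) (n : nat) :
  infinite_set [set: kappa] ->
  (forall m : nat, (m < n)%N -> square (iter m csucc kappa)) ->
  exists (d : Order.disp_t) (L : latticeType d),
    is_ladder n.+1 kappa L /\ [set: L] #= [set: iter n csucc kappa].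
Proof.
move=> kinf sq.
have inf m : infinite_set [set: iter m csucc kappa].
  by elim: m => //= m; apply: csucc_infinite.
have [d [L [e [Llad Lcard _ _ _]]]] : coded_ladder n kappa (iter n csucc kappa).
  elim: n sq => [_|n IH sq]; first exact: coded_ladder_base.
  apply: coded_ladder_step => //; [exact: inf|exact: sq|].
  by apply: IH => m mn; apply: sq; apply: ltnW.
by exists d, L.
Qed.
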